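(* Let $t$ be a fixed positive integer. Assume that for each positive integer $n$ (with $n \ge t$) there exists a perfect $t$-deletion code $C_n$ of length $n$. Then $$\# C_n \sim M^t(n) \sim \frac{t!\, 2^n}{n^t}.$$
   Context: Let $\mathbb{B}=\{0,1\}$ and $\mathbb{B}^n$ the set of binary sequences of length $n$ ($\mathbb{B}^0=\{\epsilon\}$, the empty word). For a binary sequence $\mathbf{x}$, $\mathrm{dS}^t(\mathbf{x})$ denotes the set of sequences obtained from $\mathbf{x}$ by deleting exactly $t$ symbols, and for a set $X$ of sequences, $\mathrm{dS}^t(X)=\bigcup_{\mathbf{x}\in X}\mathrm{dS}^t(\mathbf{x})$. A set $C$ of binary sequences is a $t$-deletion code if $\mathrm{dS}^t(\mathbf{c})\cap \mathrm{dS}^t(\mathbf{d})=\emptyset$ for all distinct $\mathbf{c},\mathbf{d}\in C$; it is a $t$-deletion code of length $n$ if moreover $C\subseteq \mathbb{B}^n$. For $n\ge t$, a $t$-deletion code $C$ of length $n$ is perfect if $\mathrm{dS}^t(C)=\mathbb{B}^{n-t}$. $M^t(n)$ denotes the maximum cardinality of a $t$-deletion code of length $n$. For $f,g:\mathbb{Z}_{>0}\to\mathbb{R}$, $f(n)\sim g(n)$ means $\lim_{n\to\infty} f(n)/g(n)=1$. $\#X$ is the cardinality of $X$. *)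

(* Defs.v *)
From HB Require Import structures.
From mathcomp Require Import all_boot all_order all_algebra.
From mathcomp Require Import all_classical all_reals all_analysis.

Set Implicit Arguments.
Unset Strict Implicit.
Unset Printing Implicit Defensive.

Import Order.TTheory GRing.Theory Num.Theory.
Import numFieldNormedType.Exports.

Local Open Scope set_scope.

(* The mask [m] is [true] on the positions that are kept. If [n < t] no mask
   of length [n] has [t] deleted positions, so the set is empty even though
   the truncated length [n - t] is 0. *)
Definition dS (t n : nat) (x : n.-tuple bool) : {set (n - t).-tuple bool} :=
  [set y : (n - t).-tuple bool |
    [exists m : n.-tuple bool,
      (count_mem false m == t) && (mask m x == y :> seq bool)]].

Definition dS_set (t n : nat) (X : {set n.-tuple bool}) :
    {set (n - t).-tuple bool} :=
  \bigcup_(x in X) dS t x.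

Definition deletion_code (t n : nat) (C : {set n.-tuple bool}) : bool :=
  [forall c in C, forall d in C, (c != d) ==> (dS t c :&: dS t d == finset.set0)].

(* Only meaningful for [t <= n]. *)
Definition perfect_deletion_code (t n : nat) (C : {set n.-tuple bool}) : bool :=
  deletion_code t C && (dS_set t C == [set: (n - t).-tuple bool]).

Definition max_deletion_code (t n : nat) : nat :=
  \max_(C : {set n.-tuple bool} | deletion_code t C) #|C|.

Local Open Scope ring_scope.
Local Open Scope classical_set_scope.

(* Functions on the positive integers are represented on [nat]; the value at 0
   does not affect the limit. *)
Definition asymp_equiv (R : realType) (f g : nat -> R) : Prop :=
  (fun n : nat => f n / g n) @ \oo --> (1 : R).

(* Main.v *)
Require Import Defs.
From HB Require Import structures.
From mathcomp Require Import all_boot all_order all_algebra.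
From mathcomp Require Import all_classical all_reals all_analysis.
From mathcomp Require Import zify ring lra.

(* If a word has k positions where consecutive letters differ, deleting t
   letters yields at least C(k + 1 - t, t) and at most C(k + t, t) words; both
   are asymptotic to k^t / t!.  A Chernoff bound shows that k is close to n / 2
   for all words of length n but a set of size o(2^n / n^t), so a codeword
   typically accounts for about (n / 2)^t / t! of the 2^(n - t) words of length
   n - t.  Disjointness of the deletion sets bounds every code from above, and
   covering bounds a perfect code from below. *)

Import Order.TTheory GRing.Theory Num.Theory.
Import numFieldNormedType.Exports.

Local Open Scope nat_scope.

(** * Letter changes and deletion sets *)

(** For a nonempty word this is the number of runs minus one. *)
Fixpoint changes (x : seq bool) : nat :=
  if x is a :: x' then (if x' is b :: _ then a != b : nat else 0) + changes x'
  else 0.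

Lemma changes_cons2 a b x :
  changes (a :: b :: x) = (b != a) + changes (b :: x).
Proof. by rewrite eq_sym. Qed.

Lemma changes_ltn_size x : 0 < size x -> changes x < size x.
Proof.
elim: x => [//|a [|b x] IH] _; first by [].
by have := IH isT; rewrite changes_cons2 /=; case: (b != a) => /=; lia.
Qed.

Lemma mem_dS t n (x : n.-tuple bool) (y : (n - t).-tuple bool) :
  t <= n -> (y \in dS t x) = subseq y x.
Proof.
move=> tn; rewrite inE; apply/existsP/subseqP => [[m /andP[/eqP cm /eqP my]]|].
  by exists m; rewrite ?size_tuple.
move=> [m sm ym]; have sm' : size m == n by rewrite sm size_tuple.
exists (Tuple sm') => /=; rewrite -ym eqxx andbT.
have := size_mask sm; rewrite -ym size_tuple => e.
have := count_predC id m; rewrite sm size_tuple -e.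
have -> : count_mem false m = count (predC id) m by apply: eq_count => -[].
by move=> h; apply/eqP; lia.
Qed.

(** * Upper bound on the size of a deletion set *)

(* [subwords false x t] lists the words obtained by deleting [t] letters of
   [x]; with [true], only those keeping the whole first run of [x].  If a
   letter of the first run is deleted, it may be taken to be the first one,
   which makes the list short enough. *)
Fixpoint subwords (keep : bool) (x : seq bool) (t : nat) : seq (seq bool) :=
  if x is a :: x' then
    map (cons a) (subwords (ohead x' == Some a) x' t) ++
    (if ~~ keep then if t is t'.+1 then subwords false x' t' else [::]
     else [::])
  else if t is 0 then [:: [::]] else [::].

Lemma subseq_subwords x t y :
  subseq y x -> size y + t = size x -> y \in subwords false x t.
Proof.
have split_keep a x' t' z : z \in subwords false (a :: x') t' ->
    z \in subwords true (a :: x') t' \/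
    (exists2 t'', t' = t''.+1 & z \in subwords false x' t'').
  rewrite /= cats0 mem_cat => /orP[|]; first by left.
  by case: t' => // t'' h; right; exists t''.
(* If [x'] begins with [a] and [z] arises by deleting that letter, deleting the [a] in front instead
   gives the same word; this pushes a deletion to the start of its run. *)
have cons_sub a x' t' z : z \in subwords false x' t' ->
    a :: z \in subwords false (a :: x') t'.
  elim: x' a t' z => [|b x' IH] a t' z.
    by move=> h /=; rewrite mem_cat map_f.
  have eqS : (Some b == Some a) = (b == a) by [].
  move=> h; rewrite [subwords _ (a :: _) _]/= mem_cat eqS.
  case: (eqVneq b a) => [ba|nba].
    subst b; case/split_keep: (h) => [hk|[t'' -> hz]].
      by rewrite (map_f (cons a) hk).
    by apply/orP; right; exact: IH.
  by rewrite (map_f (cons a) h).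
elim: x t y => [|a x IH] t y.
  by move=> /eqP -> /=; rewrite add0n => ->.
case: y => [|b y].
  move=> _ /= st; rewrite add0n in st; subst t.
  by rewrite mem_cat IH ?orbT ?sub0seq.
move=> /= sy st; case: eqVneq sy => [-> sy|_ sy].
  by apply: cons_sub; apply: IH => //; move: st; rewrite addSn => -[].
rewrite mem_cat; case: t st => [st|t st].
  by have := size_subseq sy; rewrite /= -ltnS -st addn0 ltnn.
by rewrite (IH t (b :: y)) ?orbT//=; move: st; rewrite addnS => -[].
Qed.

Lemma subwords_true_cons2 a b x t :
  subwords true (a :: b :: x) t =
    map (cons a) (subwords (b == a) (b :: x) t).
Proof. exact: cats0. Qed.

Lemma subwords_false_cons2 a b x t :
  subwords false (a :: b :: x) t =
    map (cons a) (subwords (b == a) (b :: x) t) ++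
    (if t is t'.+1 then subwords false (b :: x) t' else [::]).
Proof. by []. Qed.

(** The two bounds support each other: the words that keep the first letter and those that delete it
    add up by Pascal's rule. The predecessor truncates only when there is no change and [t] is 0,
    where the binomial is still 1. *)
Lemma size_subwords a x t :
  size (subwords true (a :: x) t) <= 'C((changes (a :: x) + t).-1, t) /\
  size (subwords false (a :: x) t) <= 'C(changes (a :: x) + t, t).
Proof.
elim: x a t => [|b x IH] a t.
  by case: t => [//|[|t]] //=; split; rewrite ?bin1.
have [IHk IHf] := IH b t.
rewrite changes_cons2 subwords_true_cons2 subwords_false_cons2.
rewrite !size_cat !size_map.
set k := changes (b :: x) in IHk IHf *.
have [ba|nba] := eqVneq b a.
  subst b; rewrite add0n; split=> //.
  case: t IHk IHf => [|t] IHk IHf; first by rewrite !addn0 !bin0 in IHk *.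
  have [_ IHt] := IH a t.
  by rewrite addnS binS; apply: leq_add => //; rewrite addnS in IHk.
rewrite add1n; split=> //.
case: t IHk IHf => [|t] IHk IHf; first by rewrite !addn0 !bin0 in IHf *.
have [_ IHt] := IH b t.
rewrite addnS binS addSn; apply: leq_add; first by rewrite addnS in IHf.
by apply: leq_trans IHt _; rewrite leq_bin2l.
Qed.

Lemma card_dS_le t n (x : n.+1.-tuple bool) :
  t <= n.+1 -> #|dS t x| <= 'C(changes x + t, t).
Proof.
move=> tn; have : size x = n.+1 by rewrite size_tuple.
case: {-1}(tval x) (erefl (tval x)) => [//|a s] xs _.
apply: leq_trans (size_subwords a s t).2.
rewrite -xs cardE -(size_map val); apply: uniq_leq_size.
  by rewrite map_inj_uniq ?enum_uniq//; exact: val_inj.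
move=> z /mapP[y]; rewrite mem_enum mem_dS// => yx ->.
by apply: subseq_subwords => //; rewrite !size_tuple subnK.
Qed.

(** * Lower bound on the size of a deletion set *)

(* Some pairwise distinct words obtained by deleting [t] letters of [x]; the
   two families have different first letters. *)
Fixpoint subwords_lo (x : seq bool) (t : nat) : seq (seq bool) :=
  if t isn't t'.+1 then [:: x] else
  if x is a :: x' then
    if x' is b :: x'' then
      map (cons a) (subwords_lo x' t) ++
      (if a == b then [::] else map (cons b) (subwords_lo x'' t'))
    else [::]
  else [::].

Lemma subwords_lo_cons2 a b x t :
  subwords_lo (a :: b :: x) t.+1 =
    map (cons a) (subwords_lo (b :: x) t.+1) ++
    (if a == b then [::] else map (cons b) (subwords_lo x t)).
Proof. by []. Qed.

(** [subwords_lo] recurses on the tail and on the tail of the tail, so the induction needs a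
    hypothesis for both. *)
Lemma subwords_lo_ind (P : seq bool -> Prop) :
  P [::] -> (forall a, P [:: a]) ->
  (forall a b x, P x -> P (b :: x) -> P (a :: b :: x)) -> forall x, P x.
Proof.
move=> P0 P1 P2 x.
suff : P x /\ forall a, P (a :: x) by case.
elim: x => [|b x [Px IH]]; first by split.
by split => // a; apply: P2.
Qed.

Lemma subwords_loP x t y :
  y \in subwords_lo x t -> subseq y x /\ size y + t = size x.
Proof.
have t0 z s : z \in subwords_lo s 0 -> subseq z s /\ size z + 0 = size s.
  have -> : subwords_lo s 0 = [:: s] by case: s.
  by rewrite inE => /eqP ->; rewrite addn0; split; first exact: subseq_refl.
move: t y; elim/subwords_lo_ind: x => [|a|a b x IHx IHbx] [|t] y; do ?exact: t0.
- by [].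
- by [].
rewrite subwords_lo_cons2 mem_cat => /orP[/mapP[z /IHbx[zs st] ->]|].
  by rewrite [subseq _ _]/= eqxx; split => //=; rewrite addSn st.
case: eqVneq => // nab /mapP[z /IHx[zs st] ->].
by rewrite /= eq_sym (negbTE nab) eqxx; split=> //; rewrite addSn addnS st.
Qed.

Lemma uniq_subwords_lo x t : uniq (subwords_lo x t).
Proof.
move: t; elim/subwords_lo_ind: x => [|a|a b x IHx IHbx] [|t] //.
have icons (c : bool) : injective (cons c) by move=> u v [].
rewrite subwords_lo_cons2 cat_uniq map_inj_uniq// IHbx /=.
case: eqVneq => //= nab; rewrite map_inj_uniq// IHx andbT.
apply/hasPn => _ /mapP[z _ ->]; apply/negP => /mapP[z' _ [ba _]].
by rewrite ba eqxx in nab.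
Qed.

(** Pascal's rule again: when the first two letters differ, the two families match its two terms,
    since dropping [b] from [b :: x] loses at most one change. *)
Lemma size_subwords_lo x t : 'C(changes x + 1 - t, t) <= size (subwords_lo x t).
Proof.
move: t; elim/subwords_lo_ind: x => [|a|a b x IHx IHbx] [|t] //.
  by rewrite bin0.
rewrite subwords_lo_cons2 size_cat size_map changes_cons2.
have := IHbx t.+1; set k := changes (b :: x) => hb.
rewrite eq_sym; case: (eqVneq a b) => [ab|nab]; first by rewrite add0n addn0.
rewrite size_map.
have kx : k <= changes x + 1.
  rewrite /k /= addnC leq_add2l.
  by case: x {IHx IHbx k hb} => // c x; case: (b != c).
case: (leqP t k) => tk; last by rewrite bin_small//; lia.
have -> : 1 + k + 1 - t.+1 = (k - t).+1 by lia.
rewrite binS; apply: leq_add.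
  by have -> : k - t = k + 1 - t.+1 by lia.
by apply: leq_trans (IHx t); rewrite leq_bin2l//; lia.
Qed.

Lemma card_dS_ge t n (x : n.-tuple bool) :
  t <= n -> 'C(changes x + 1 - t, t) <= #|dS t x|.
Proof.
move=> tn; apply: leq_trans (size_subwords_lo x t) _.
rewrite cardE -(size_map val); apply: uniq_leq_size (uniq_subwords_lo x t) _.
move=> y /subwords_loP[yx]; rewrite size_tuple => sy.
have sy' : size y == n - t by apply/eqP; lia.
by apply/mapP; exists (Tuple sy') => //; rewrite mem_enum mem_dS.
Qed.

(** * Counting over disjoint deletion sets *)

Lemma sum_dS_code t n (D : {set n.-tuple bool}) :
  deletion_code t D -> \sum_(c in D) #|dS t c| = #|dS_set t D|.
Proof.
move=> /forall_inP codeD.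
(* Extended by the empty set outside [D], the family is pairwise disjoint over the whole type. *)
pose F c := if c \in D then dS t c else finset.set0.
have -> : dS_set t D = \bigcup_c F c.
  by rewrite /dS_set big_mkcond.
rewrite -sum1_card partition_disjoint_bigcup; last first.
  move=> c d cd; rewrite -setI_eq0 /F.
  case: ifP => [cD|_]; last by rewrite finset.set0I.
  case: ifP => [dD|_]; last by rewrite finset.setI0.
  by move/forall_inP: (codeD c cD) => /(_ d dD); rewrite cd.
rewrite big_mkcond; apply: eq_bigr => c _; rewrite sum1_card /F.
by case: ifP; rewrite ?cards0.
Qed.

Local Open Scope ring_scope.

(** * Concentration of the number of changes *)

Lemma big_tuple_cons (R : Type) (idx : R) (op : Monoid.com_law idx)
    (T : finType) n (F : n.+1.-tuple T -> R) :
  \big[op/idx]_x F x =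
  \big[op/idx]_a \big[op/idx]_(x : n.-tuple T) F [tuple of a :: x].
Proof.
rewrite pair_big /=.
rewrite (reindex (fun p : T * n.-tuple T => [tuple of p.1 :: p.2])) //.
exists (fun x => (thead x, [tuple of behead x])) => [[a x] _|x _] /=.
  by congr pair; apply: val_inj.
by rewrite [RHS]tuple_eta; apply: val_inj.
Qed.

(** Once the first letter is fixed, each of the [n] later letters independently makes a change
    (weight [u]) or not (weight [v]). The factor 2 counts the first letters. *)
Lemma sum_changes (R : comPzRingType) (u v : R) n :
  \sum_(x : n.+1.-tuple bool) u ^+ changes x * v ^+ (n - changes x) =
  2 * (u + v) ^+ n.
Proof.
have headE a : \sum_(x : n.-tuple bool)
    u ^+ changes (a :: x) * v ^+ (n - changes (a :: x)) = (u + v) ^+ n.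
  elim: n a => [|n IH] a.
    rewrite (big_pred1 [tuple]) /=; first by rewrite !expr0 mulr1.
    by move=> x; rewrite [x]tuple0; apply/esym/eqP.
  rewrite big_tuple_cons.
  transitivity (\sum_(b : bool) (if b == a then v else u) * (u + v) ^+ n).
    apply: eq_bigr => b _; rewrite -(IH b) mulr_sumr; apply: eq_bigr => x _.
    rewrite [tval _]/= changes_cons2.
    have : (changes (b :: x) < (size x).+1)%N by exact: changes_ltn_size.
    rewrite size_tuple ltnS => le_n; case: eqVneq => _ /=.
      by rewrite add0n subSn// exprS; ring.
    by rewrite add1n subSS exprS; ring.
  by rewrite big_bool exprS; case: a => /=; ring.
rewrite big_tuple_cons big_bool /= !headE; ring.
Qed.

(** A word of length [n.+1] has [n] places for a change, so twice the number of changes minus [n] is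
    a sum of [n] signs. *)
Definition atypical {R : realType} (eta : R) n : {set n.+1.-tuple bool} :=
  [set x : n.+1.-tuple bool | eta * n%:R < `|2 * (changes x)%:R - n%:R|]%SET.

(* With [s = eta], the moment [E exp (s (2 k - n))] of the number [k] of
   changes is [cosh s ^ n], and [expR (- x) <= (1 + x)^-1] bounds
   [cosh s * expR (- s eta)] away from 1. *)
Lemma cosh_bound (R : realType) (eta : R) : 0 < eta < 1 ->
  (expR eta + expR (- eta)) * expR (- (eta * eta)) <=
  2 * expR (- (eta ^+ 4 / 3)).
Proof.
move=> /andP[eta0 eta1].
have inv_bound (y : R) : 0 < 1 + y -> expR (- y) <= (1 + y)^-1.
  by move=> y0; rewrite expRN lef_pV2 ?posrE ?expR_gt0// expR_ge1Dx.
have h1 := inv_bound (eta * eta - eta).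
have h2 := inv_bound (eta * eta + eta).
rewrite mulrDl -!expRD.
have -> : eta - eta * eta = - (eta * eta - eta) by ring.
have -> : - eta - eta * eta = - (eta * eta + eta) by ring.
have p1 : 0 < 1 + (eta * eta - eta) by nra.
have p2 : 0 < 1 + (eta * eta + eta) by nra.
apply: le_trans (lerD (h1 p1) (h2 p2)) _.
have := expR_ge1Dx (- (eta ^+ 4 / 3)).
set w := expR _ => hw.
set u := eta * eta.
have u0 : 0 < u by rewrite mulr_gt0.
have u1 : u < 1 by rewrite /u; nra.
have -> : (1 + (u - eta))^-1 + (1 + (u + eta))^-1 =
    2 * ((1 + u) / (1 + u + u ^+ 2)).
  have q : 1 + u + u ^+ 2 = (1 + (u - eta)) * (1 + (u + eta)).
    by rewrite /u; ring.
  rewrite q; field; rewrite -/u in p1 p2; by rewrite !gt_eqF.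
rewrite ler_pM2l//; apply: le_trans hw.
have -> : eta ^+ 4 = u ^+ 2 by rewrite /u; ring.
have qp : 0 < 1 + u + u ^+ 2 by nra.
rewrite ler_pdivrMr//.
(* The 3 in the exponent bounds [1 + u + u ^+ 2], as [u < 1]. *)
have : 0 <= u ^+ 2 * (2 - u - u ^+ 2) by rewrite mulr_ge0 ?sqr_ge0//; nra.
nra.
Qed.

(** Markov's inequality for the sum of the exponentials with parameters [eta] and [- eta], which
    catches both tails at once. The 4 is two tails times two first letters. *)
Lemma card_atypical (R : realType) (eta : R) n : 0 < eta < 1 ->
  #|atypical eta n|%:R <= 4 * 2 ^+ n * expR (- (eta ^+ 4 / 3)) ^+ n.
Proof.
move=> eta01; have /andP[eta0 eta1] := eta01.
set d := expR (- (eta ^+ 4 / 3)).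
have wE s (x : n.+1.-tuple bool) :
    expR s ^+ changes x * expR (- s) ^+ (n - changes x) =
    expR (s * (2 * (changes x)%:R - n%:R)) :> R.
  have : (changes x < size x)%N by apply: changes_ltn_size; rewrite size_tuple.
  rewrite size_tuple ltnS => le_n; rewrite -!expRM_natl -expRD natrB//.
  by congr expR; ring.
have moment : \sum_(x : n.+1.-tuple bool)
    (expR (eta * (2 * (changes x)%:R - n%:R)) +
     expR (- eta * (2 * (changes x)%:R - n%:R))) =
    4 * (expR eta + expR (- eta)) ^+ n :> R.
  rewrite big_split /=.
  under eq_bigr do rewrite -wE.
  rewrite sum_changes.
  under eq_bigr do rewrite -wE opprK.
  by rewrite sum_changes (addrC (expR (- eta))); ring.
have markov : #|atypical eta n|%:R * expR (eta * eta) ^+ n <=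
    4 * (expR eta + expR (- eta)) ^+ n.
  rewrite -moment mulr_natl -sumr_const [leLHS]big_mkcond /=.
  apply: ler_sum => x _; case: ifP => [|_]; last by rewrite addr_ge0 ?expR_ge0.
  rewrite inE -expRM_natr -mulrA => hx.
  case: (lerP 0 (2 * (changes x)%:R - n%:R : R)) => h0.
    rewrite ger0_norm// in hx.
    apply: le_trans (_ : expR (eta * (2 * (changes x)%:R - n%:R)) <= _).
      by rewrite ler_expR ler_pM2l// ltW.
    by rewrite lerDl expR_ge0.
  rewrite ltr0_norm// in hx.
  apply: le_trans (_ : expR (- eta * (2 * (changes x)%:R - n%:R)) <= _).
    by rewrite mulNr -mulrN ler_expR ler_pM2l// ltW.
  by rewrite lerDr expR_ge0.
rewrite -(ler_pM2r (exprn_gt0 n (expR_gt0 (eta * eta)))).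
apply: le_trans markov _; rewrite -!mulrA ler_pM2l// -!exprMn.
apply: lerXn2r; rewrite ?nnegrE ?mulr_ge0 ?addr_ge0 ?expR_ge0//.
have := cosh_bound _ _ eta01; rewrite -/d [expR (- (eta * eta))]expRN.
by rewrite ler_pdivrMr ?expR_gt0// mulrA.
Qed.

(** Exponential decay beats any power of the length. The power [t.+1], one above the normalisation,
    makes the relative error of order 1/n. *)
Lemma card_atypical_poly (R : realType) (eta : R) t : 0 < eta < 1 ->
  exists2 K : R, 0 <= K &
    forall n, (0 < n)%N ->
      #|atypical eta n|%:R * n.+1%:R ^+ t.+1 <= K * 2 ^+ n.+1.
Proof.
move=> eta01; have /andP[eta0 eta1] := eta01.
pose d := eta ^+ 4 / 3; have d0 : 0 < d by rewrite divr_gt0// exprn_gt0.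
exists (2 * ((2 / d) ^+ t.+1 * t.+1`!%:R)) => [|n n0].
  by rewrite mulr_ge0// mulr_ge0// exprn_ge0// divr_ge0// ltW.
have f0 : 0 < t.+1`!%:R :> R by rewrite ltr0n fact_gt0.
have powexp : n.+1%:R ^+ t.+1 * expR (- d) ^+ n <= (2 / d) ^+ t.+1 * t.+1`!%:R.
  have := expR_ge1Dxn t (mulr_ge0 (ler0n R n) (ltW d0)).
  rewrite expRM_natl => h.
  have {}h : (n%:R * d) ^+ t.+1 <= expR d ^+ n * t.+1`!%:R.
    by rewrite -ler_pdivrMr//; apply: le_trans h; rewrite lerDr.
  rewrite expRN exprVn ler_pdivrMr ?exprn_gt0 ?expR_gt0//.
  rewrite -mulrA (mulrC t.+1`!%:R).
  apply: le_trans (ler_wpM2l _ h); last by rewrite exprn_ge0// divr_ge0// ltW.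
  (* The 2 in [2 / d] absorbs the shift: [n.+1 <= 2 * n] for positive [n]. *)
  have nE : 2 / d * (n%:R * d) = 2 * n%:R by field; rewrite gt_eqF.
  rewrite -exprMn nE; apply: lerXn2r; rewrite ?nnegrE ?mulr_ge0//.
  by rewrite -natrM ler_nat; lia.
apply: le_trans (_ : 4 * 2 ^+ n * expR (- d) ^+ n * n.+1%:R ^+ t.+1 <= _).
  by rewrite ler_wpM2r ?exprn_ge0// card_atypical.
have -> : 2 * ((2 / d) ^+ t.+1 * t.+1`!%:R) * 2 ^+ n.+1 =
   (4 * 2 ^+ n) * ((2 / d) ^+ t.+1 * t.+1`!%:R) by rewrite (exprS _ n); ring.
by rewrite -mulrA ler_pM2l ?mulr_gt0 ?exprn_gt0// mulrC.
Qed.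

(** * Deletion sets of typical words *)

Lemma ffact_le_expn n t : (n ^_ t <= n ^ t)%N.
Proof.
elim: t => [|t IH]; first by rewrite ffactn0.
by rewrite ffactnSr expnSr leq_mul// leq_subr.
Qed.

Lemma expn_le_ffact n t : ((n.+1 - t) ^ t <= n ^_ t)%N.
Proof.
elim: t => [|t IH]; first by rewrite ffactn0.
rewrite ffactnSr expnSr subSS leq_mul//; apply: leq_trans IH.
by case: t => // t; rewrite leq_exp2r//; lia.
Qed.

Lemma fact_card_dS_le t n (x : n.+1.-tuple bool) :
  (t <= n.+1 -> t`! * #|dS t x| <= (changes x + t) ^ t)%N.
Proof.
move=> tn; apply: leq_trans (ffact_le_expn _ _).
by rewrite -bin_ffact mulnC leq_mul2r card_dS_le ?orbT.
Qed.

Lemma fact_card_dS_ge t n (x : n.-tuple bool) :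
  (t <= n -> (changes x - t.*2) ^ t <= t`! * #|dS t x|)%N.
Proof.
move=> tn; have := card_dS_ge t n x tn.
rewrite -(leq_pmul2r (fact_gt0 t)) bin_ffact mulnC; apply: leq_trans.
apply: leq_trans (expn_le_ffact _ _).
by case: t tn => [//|t] tn; rewrite leq_exp2r//; lia.
Qed.

(** Half of the tolerance [2 * eta] covers the deviation of the number of changes. The other half
    covers the shifts by [t.*2] and [t] and the passage from [n] to [n.+1], by the bound on
    [4 * t%:R + 1]. *)
Lemma typical_card_dS (R : realType) (eta : R) t n (x : n.+1.-tuple bool) :
  (t <= n.+1)%N -> 0 < eta -> 2 * eta <= 1 -> 4 * t%:R + 1 <= eta * n.+1%:R ->
  x \notin atypical eta n ->
  ((1 - 2 * eta) * n.+1%:R / 2) ^+ t <= (t`! * #|dS t x|)%:R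
    <= ((1 + 2 * eta) * n.+1%:R / 2) ^+ t.
Proof.
move=> tn eta0 eta1 nlarge; rewrite inE -leNgt ler_norml => /andP[xge xle].
have n0 : 0 <= n%:R :> R by [].
have etan : 0 <= eta * n%:R by rewrite mulr_ge0// ltW.
rewrite -(natr1 n) in nlarge *; rewrite mulrDr mulr1 in nlarge.
apply/andP; split.
  apply: le_trans (_ : ((changes x - t.*2) ^ t)%:R <= _); last first.
    by rewrite ler_nat fact_card_dS_ge.
  rewrite natrX; apply: lerXn2r; rewrite ?nnegrE//.
    by rewrite !mulr_ge0// subr_ge0.
  apply: le_trans (_ : (changes x)%:R - (t.*2)%:R <= _); last first.
    by rewrite lerBlDr -natrD ler_nat; lia.
  by rewrite -muln2 natrM ler_pdivrMr//; nra.
apply: le_trans (_ : ((changes x + t) ^ t)%:R <= _).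
  by rewrite ler_nat fact_card_dS_le.
rewrite natrX; apply: lerXn2r; rewrite ?nnegrE//.
  by rewrite !mulr_ge0// addr_ge0// ltW// mulr_gt0.
by rewrite natrD ler_pdivlMr//; have : 0 <= t%:R :> R by []; nra.
Qed.

(** * Size bounds for codes of a given length *)

Lemma sum_indicator_le (R : numDomainType) (T : finType) (D A : {set T})
    (a : R) :
  0 <= a -> \sum_(c in D) (if c \in A then a else 0) <= #|A|%:R * a.
Proof.
move=> a0; rewrite -big_mkcondr /= sumr_const -[leLHS]mulr_natl ler_wpM2r//.
rewrite ler_nat; apply: subset_leq_card; apply/fintype.subsetP => c.
by rewrite unfold_in => /andP[].
Qed.

(** Packing: the disjoint deletion sets fit into the words of length [n.+1 - t], and a typical
    codeword takes at least [L / t!] of them. Atypical codewords are credited [L] each as an error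
    term. *)
Lemma card_code_le (R : realType) (eta : R) t n
    (D : {set n.+1.-tuple bool}) :
  (t <= n.+1)%N -> 0 < eta -> 2 * eta <= 1 -> 4 * t%:R + 1 <= eta * n.+1%:R ->
  deletion_code t D ->
  #|D|%:R * ((1 - 2 * eta) * n.+1%:R) ^+ t <=
    t`!%:R * 2 ^+ n.+1 + #|atypical eta n|%:R * n.+1%:R ^+ t.
Proof.
move=> tn eta0 eta1 nlarge codeD.
pose L : R := ((1 - 2 * eta) * n.+1%:R / 2) ^+ t.
have L0 : 0 <= L by rewrite exprn_ge0// !mulr_ge0// subr_ge0.
have LE : ((1 - 2 * eta) * n.+1%:R) ^+ t = L * 2 ^+ t.
  by rewrite -exprMn divfK.
have pow2 : 2 ^+ n.+1 = 2 ^+ (n.+1 - t) * 2 ^+ t :> R.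
  by rewrite -exprD subnK.
have L_le : L * 2 ^+ t <= n.+1%:R ^+ t.
  rewrite -LE; apply: lerXn2r; rewrite ?nnegrE ?mulr_ge0 ?subr_ge0//.
  by rewrite ler_piMl// gerBl mulr_ge0// ltW.
have sumD : #|D|%:R * L <= t`!%:R * 2 ^+ (n.+1 - t) + #|atypical eta n|%:R * L.
  apply: le_trans (_ : \sum_(c in D) ((t`! * #|dS t c|)%:R +
      (if c \in atypical eta n then L else 0)) <= _).
    rewrite mulr_natl -sumr_const; apply: ler_sum => c _.
    case: ifPn => [_|/typical_card_dS h]; first by rewrite lerDr.
    by rewrite addr0; have /andP[] := h t tn eta0 eta1 nlarge.
  rewrite big_split /= lerD ?sum_indicator_le//.
  rewrite -natr_sum -big_distrr /= sum_dS_code// natrM ler_wpM2l//.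
  rewrite -natrX ler_nat; apply: leq_trans (max_card _) _.
  by rewrite card_tuple card_bool.
rewrite LE pow2 !mulrA.
apply: le_trans (ler_wpM2r (exprn_ge0 t _) sumD) _ => //.
by rewrite mulrDl lerD2l -mulrA ler_wpM2l.
Qed.

Lemma card_perfect_ge (R : realType) (eta : R) t n
    (D : {set n.+1.-tuple bool}) :
  (t <= n.+1)%N -> 0 < eta -> 2 * eta <= 1 -> 4 * t%:R + 1 <= eta * n.+1%:R ->
  perfect_deletion_code t D ->
  t`!%:R * 2 ^+ n.+1 <= #|D|%:R * ((1 + 2 * eta) * n.+1%:R) ^+ t +
    #|atypical eta n|%:R * (4 * n.+1%:R) ^+ t.
Proof.
move=> tn eta0 eta1 nlarge /andP[codeD /eqP fullD].
pose U : R := ((1 + 2 * eta) * n.+1%:R / 2) ^+ t.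
(* [V] is a crude bound valid for every codeword, from [changes c + t <= 2 * n.+1]. *)
pose V : R := (2 * n.+1%:R) ^+ t.
have V0 : 0 <= V by rewrite exprn_ge0.
have U0 : 0 <= U by rewrite exprn_ge0// !mulr_ge0// addr_ge0// ltW// mulr_gt0.
have UE : ((1 + 2 * eta) * n.+1%:R) ^+ t = U * 2 ^+ t.
  by rewrite -exprMn divfK.
have VE : (4 * n.+1%:R) ^+ t = V * 2 ^+ t.
  by rewrite -exprMn; congr (_ ^+ _); ring.
have pow2 : 2 ^+ n.+1 = 2 ^+ (n.+1 - t) * 2 ^+ t :> R.
  by rewrite -exprD subnK.
have sumD : t`!%:R * 2 ^+ (n.+1 - t) <= #|D|%:R * U + #|atypical eta n|%:R * V.
  have -> : t`!%:R * 2 ^+ (n.+1 - t) = \sum_(c in D) (t`! * #|dS t c|)%:R :> R.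
    rewrite -natr_sum -big_distrr /= sum_dS_code// fullD cardsT card_tuple.
    by rewrite card_bool natrM natrX.
  apply: le_trans (_ : \sum_(c in D)
      (U + (if c \in atypical eta n then V else 0)) <= _).
    apply: ler_sum => c _.
    case: ifPn => [_|/typical_card_dS h]; last first.
      by rewrite addr0; have /andP[] := h t tn eta0 eta1 nlarge.
    apply: le_trans (_ : V <= _); last by rewrite lerDr.
    rewrite /V -natrM -natrX ler_nat.
    apply: leq_trans (fact_card_dS_le _ _ _ tn) _.
    have : (changes c < size c)%N
      by apply: changes_ltn_size; rewrite size_tuple.
    rewrite size_tuple => ch.
    case: t tn {nlarge codeD fullD U V V0 U0 UE VE pow2} => [//|t] tn.
    by rewrite leq_exp2r// mul2n -addnn leq_add// ltnW.
  by rewrite big_split /= sumr_const mulr_natl lerD ?sum_indicator_le.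
rewrite UE VE pow2 !mulrA -mulrDl; exact: ler_wpM2r.
Qed.

(** * Asymptotics of code sizes *)

Lemma bernoulli_sub (R : realDomainType) (x : R) t :
  0 <= x <= 1 -> 1 - t%:R * x <= (1 - x) ^+ t.
Proof.
move=> /andP[x0 x1]; elim: t => [|t IH]; first by rewrite expr0 mul0r subr0.
rewrite exprSr; apply: le_trans (_ : (1 - t%:R * x) * (1 - x) <= _); last first.
  by rewrite ler_wpM2r// subr_ge0.
rewrite -(natr1 t); have : 0 <= t%:R * (x * x) by rewrite !mulr_ge0.
nra.
Qed.

(** The threshold on [n] is uniform in [D], so it serves a maximum code and the given perfect code
    alike. *)
Lemma code_size_asymptotics (R : realType) t (delta : R) :
  (0 < t)%N -> 0 < delta < 1 ->
  \forall n \near \oo%classic, forall D : {set n.-tuple bool},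
    (deletion_code t D ->
      #|D|%:R / (t`!%:R * 2 ^+ n / n%:R ^+ t) <= 1 + delta) /\
    (perfect_deletion_code t D ->
      1 - delta <= #|D|%:R / (t`!%:R * 2 ^+ n / n%:R ^+ t)).
Proof.
move=> t0 /andP[d0 d1].
have tR : 1 <= t%:R :> R by rewrite ler1n.
(* Chosen so that Bernoulli's inequality loses only [delta / 4] in the [t]-th power. *)
pose eta : R := delta / (8 * t%:R).
have etaE : t%:R * (2 * eta) = delta / 4 by rewrite /eta; field; rewrite gt_eqF; lra.
have eta0 : 0 < eta by rewrite divr_gt0//; lra.
have eta1 : 2 * eta <= delta / 4.
  by rewrite -etaE ler_peMl// mulr_ge0// ltW.
have [K K0 HK] : exists2 K : R, 0 <= K & forall n, (0 < n)%N ->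
    #|atypical eta n|%:R * n.+1%:R ^+ t.+1 <= K * 2 ^+ n.+1.
  by apply: card_atypical_poly; apply/andP; split => //; lra.
have bern : 1 - delta / 4 <= (1 - 2 * eta) ^+ t.
  by rewrite -etaE; apply: bernoulli_sub; lra.
suff large n : (1 < n)%N -> (t <= n)%N -> (4 * t%:R + 1) / eta <= n%:R ->
    4 ^+ t * K * 4 / delta <= n%:R -> forall D : {set n.-tuple bool},
    (deletion_code t D ->
      #|D|%:R / (t`!%:R * 2 ^+ n / n%:R ^+ t) <= 1 + delta) /\
    (perfect_deletion_code t D ->
      1 - delta <= #|D|%:R / (t`!%:R * 2 ^+ n / n%:R ^+ t)).
  near=> n; apply: large; near: n.
  - exact: nbhs_infty_ge.
  - exact: nbhs_infty_ge.
  - exact: nbhs_infty_ger.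
  - exact: nbhs_infty_ger.
case: n => [//|n] n2 tn nlarge errlarge D.
rewrite ler_pdivrMr// (mulrC n.+1%:R) in nlarge.
have N0 : 0 < n.+1%:R :> R by [].
have Nt0 : 0 < n.+1%:R ^+ t :> R by rewrite exprn_gt0.
have P0 : 0 < t`!%:R * 2 ^+ n.+1 :> R by rewrite mulr_gt0 ?exprn_gt0// ltr0n fact_gt0.
set T := t`!%:R * 2 ^+ n.+1 in P0 *.
set A : R := #|atypical eta n|%:R.
have four1 : 1 <= 4 ^+ t :> R by rewrite exprn_ege1// ler1n.
(* The spare factor [n.+1] from [HK] outweighs the constant [4 ^+ t * K] by [errlarge]. *)
have AT : A * (4 * n.+1%:R) ^+ t <= delta / 4 * T.
  have h1 : A * n.+1%:R ^+ t * n.+1%:R <= K * T.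
    rewrite -mulrA -exprSr; apply: le_trans (HK n _) _ => //.
    by rewrite ler_wpM2l// ler_peMl ?exprn_ge0// ler1n fact_gt0.
  rewrite exprMn -(ler_pM2r N0).
  have -> : A * (4 ^+ t * n.+1%:R ^+ t) * n.+1%:R =
      4 ^+ t * (A * n.+1%:R ^+ t * n.+1%:R) by ring.
  apply: le_trans (ler_wpM2l _ h1) _; first by rewrite exprn_ge0.
  rewrite ler_pdivrMr// in errlarge.
  have := ler_wpM2r (ltW P0) errlarge; nra.
have AT' : A * n.+1%:R ^+ t <= delta / 4 * T.
  apply: le_trans AT; rewrite ler_wpM2l// exprMn ler_peMl// ltW//.
rewrite invf_div mulrA.
set Y := #|D|%:R * n.+1%:R ^+ t.
have Y0 : 0 <= Y by rewrite mulr_ge0// ltW.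
have eta2 : 2 * eta <= 1 by lra.
split=> [codeD|perfD].
  have := card_code_le _ _ _ _ _ tn eta0 eta2 nlarge codeD.
  rewrite -/T -/A exprMn (mulrCA #|D|%:R) mulrC -/Y => h.
  rewrite ler_pdivrMr//.
  have {}h : Y * (1 - delta / 4) <= T * (1 + delta / 4).
    by apply: le_trans (ler_wpM2l Y0 bern) _; apply: le_trans h _; nra.
  (* Four times the gap in [1 + delta / 4 <= (1 + delta) * (1 - delta / 4)], scaled by [T]. *)
  have T1 : 0 <= T * delta * (2 - delta) by rewrite !mulr_ge0//; lra.
  rewrite -(ler_pM2r (_ : 0 < 1 - delta / 4)); last by lra.
  by apply: le_trans h _; nra.
have := card_perfect_ge _ _ _ _ _ tn eta0 eta2 nlarge perfD.
rewrite -/T -/A exprMn (mulrCA #|D|%:R) (mulrC _ (#|D|%:R * _)) -/Y => h.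
rewrite ler_pdivlMr//.
have {}h : T * (1 - delta / 4) <= Y * (1 + 2 * eta) ^+ t by nra.
(* Multiplying by the conjugate power avoids an upper bound on [(1 + 2 * eta) ^+ t]: the product of
   the two powers is at most 1. *)
have : T * (1 - delta / 4) * (1 - 2 * eta) ^+ t <= Y.
  apply: le_trans (ler_wpM2r _ h) _; first by rewrite exprn_ge0//; lra.
  rewrite -mulrA -exprMn ler_piMr// exprn_ile1//; nra.
apply: le_trans.
apply: le_trans (_ : T * (1 - delta / 4) * (1 - delta / 4) <= _).
  by nra.
by rewrite ler_wpM2l// mulr_ge0 ?(ltW P0)//; lra.
Unshelve. all: by end_near.
Qed.

Lemma deletion_code_set0 t n :
  deletion_code t (finset.set0 : {set n.-tuple bool}).
Proof. by apply/forall_inP => c; rewrite finset.in_set0. Qed.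

Theorem theorem1 (R : realType) (t : nat) (ht : (0 < t)%N)
    (C : forall n : nat, {set n.-tuple bool})
    (hC : forall n : nat, (t <= n)%N -> perfect_deletion_code t (C n)) :
  asymp_equiv (fun n : nat => #|C n|%:R : R)
              (fun n : nat => (max_deletion_code t n)%:R : R) /\
  asymp_equiv (fun n : nat => (max_deletion_code t n)%:R : R)
              (fun n : nat => (t`!%:R * 2 ^+ n) / (n%:R ^+ t) : R).
Proof.
pose a n : R := t`!%:R * 2 ^+ n / n%:R ^+ t.
have a_gt0 n : (0 < n)%N -> 0 < a n.
  move=> n0; apply: divr_gt0; last by rewrite exprn_gt0// ltr0n.
  by rewrite mulr_gt0 ?exprn_gt0// ltr0n fact_gt0.
(* Both normalised sizes are squeezed between the perfect-code lower bound and the general upper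
   bound. *)
have bounds (e : R) : 0 < e -> \forall n \near \oo%classic,
    1 - e <= #|C n|%:R / a n /\
    #|C n|%:R / a n <= (max_deletion_code t n)%:R / a n /\
    (max_deletion_code t n)%:R / a n <= 1 + e.
  move=> e0; pose d := Num.min e (1 / 2).
  have d0 : 0 < d by rewrite lt_min e0 divr_gt0.
  have d1 : d < 1 by rewrite gt_min; apply/orP; right; lra.
  have de : d <= e by rewrite ge_min lexx.
  have := code_size_asymptotics R t d ht; rewrite d0 d1 => /(_ isT) H.
  near=> n.
  have n0 : (0 < n)%N by near: n; exact: nbhs_infty_ge.
  have tn : (t <= n)%N by near: n; exact: nbhs_infty_ge.
  have Hn : forall D : {set n.-tuple bool},
      (deletion_code t D -> #|D|%:R / a n <= 1 + d) /\
      (perfect_deletion_code t D -> 1 - d <= #|D|%:R / a n) by near: n; exact: H.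
  have perfC := hC n tn.
  have codeC : deletion_code t (C n) by case/andP: perfC.
  split; first by apply: le_trans ((Hn _).2 perfC); rewrite lerD2l lerN2.
  split.
    rewrite ler_pM2r ?invr_gt0 ?a_gt0// ler_nat.
    exact: (leq_bigmax_cond (F := fun D : {set n.-tuple bool} => #|D|)).
  (* The maximum is attained because the family of codes is nonempty. *)
  have ex_code : (0 < #|[pred D : {set n.-tuple bool} | deletion_code t D]|)%N.
    by apply/card_gt0P; exists finset.set0; exact: deletion_code_set0.
  have [D codeD eqD] := eq_bigmax_cond (fun D : {set n.-tuple bool} => #|D|) ex_code.
  have -> : max_deletion_code t n = #|D| by rewrite -eqD.
  by apply: le_trans ((Hn D).1 codeD) _; rewrite lerD2l.
have cvgC : ((fun n => #|C n|%:R / a n) @ \oo --> (1 : R))%classic.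
  apply/cvgrPdist_le => e e0; near=> n.
  have [h1 [h2 h3]] : 1 - e <= #|C n|%:R / a n /\
    #|C n|%:R / a n <= (max_deletion_code t n)%:R / a n /\
    (max_deletion_code t n)%:R / a n <= 1 + e by near: n; exact: bounds.
  by rewrite distrC ler_distl h1 (le_trans h2 h3).
have cvgMax : ((fun n => (max_deletion_code t n)%:R / a n) @ \oo --> (1 : R))%classic.
  apply/cvgrPdist_le => e e0; near=> n.
  have [h1 [h2 h3]] : 1 - e <= #|C n|%:R / a n /\
    #|C n|%:R / a n <= (max_deletion_code t n)%:R / a n /\
    (max_deletion_code t n)%:R / a n <= 1 + e by near: n; exact: bounds.
  by rewrite distrC ler_distl h3 (le_trans h1 h2).
split; last exact: cvgMax.
rewrite /asymp_equiv.
(* The first equivalence is the quotient of the two limits, with [a n] cancelling for positive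
   [n]. *)
have quot : ((fun n => (#|C n|%:R / a n) * ((max_deletion_code t n)%:R / a n)^-1)
    @ \oo --> (1 : R))%classic.
  have := cvgM cvgC (cvgV (oner_neq0 R) cvgMax).
  by rewrite invr1 mulr1; exact.
apply: cvg_trans quot; apply: near_eq_cvg; near=> n.
have n0 : (0 < n)%N by near: n; exact: nbhs_infty_ge.
have an0 : a n != 0 by rewrite gt_eqF// a_gt0.
by move: (a n) an0 => b b0; rewrite invf_div mulrA divfK.
Unshelve. all: by end_near.
Qed.
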